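(* For every finite set $A\subset\mathbb{R}$, $$|A(A+A)|\gtrapprox |A|^{\frac{3}{2}+\frac{1}{178}},$$ where $A(A+A)=\{a(b+c): a,b,c\in A\}$.
   Context: For positive quantities $X,Y$, the notation $X\gtrapprox Y$ means that there exist absolute positive constants $C$ and $c$ such that $X\geq c\,Y/(\log X)^C$. All logarithms are to base 2. *)

(* Defs.v *)
From HB Require Import structures.
From mathcomp Require Import all_boot all_order all_algebra.
From mathcomp Require Import finmap.
From mathcomp Require Import Rstruct.
From Stdlib Require Import Reals.
Set Implicit Arguments. Unset Strict Implicit. Unset Printing Implicit Defensive.
Open Scope fset_scope.

Definition sumset (A : {fset R}) : {fset R} :=
  [fset (b + c)%R | b in A, c in A].

Definition AAplusA (A : {fset R}) : {fset R} :=
  [fset (a * s)%R | a in A, s in sumset A].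

Definition log2 (x : R) : R := (ln x / ln 2)%R.

(* Main.v *)
Require Import Defs.
From mathcomp Require Import all_boot all_order all_algebra finmap Rstruct.
From mathcomp Require Import zify ring.
Import Order.TTheory GRing.Theory Num.Theory.
Set Implicit Arguments. Unset Strict Implicit. Unset Printing Implicit Defensive.
Local Open Scope nat_scope.

(* Let [A] be a set of [n] positive reals, [M = |A(A+A)|], and let [E] be the
   multiplicative energy of [A].  Up to constants and powers of [log n]:

   - [n^6 <= M^2 E].  By Cauchy-Schwarz, [n^6 / M] is at most the number of
     solutions of [a(b+c) = a'(b'+c')], which is bounded by [E] and the third
     moment of the incidences of [A * A] with the lines of slope in [A/A].

   - [E^34 <= n^88 |A+A|^9].  If [E] is large there are a set [T] of popular
     products and a large [A'] in [A] such that each [a] in [A'] has many [c] in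
     [A] with [ac] in [T].  An equality [x = a - b] then puts many points of
     [B * T] on the lines [y = c (X + x)], which bounds the third moments of the
     representation functions of [A' - B].  Applied with [B = A'] and with
     [B = A' + A'], this feeds the argument of Schoen and Li for convex sets.

   As [|A+A| <= M], the two bounds give [n^116 <= M^77], and
   [116/77 > 3/2 + 1/178].  All the incidence problems concern cartesian products,
   for which the Szemeredi-Trotter bound follows by cutting into a grid. *)

(** * Counting representations *)

Lemma sum_eq_uniq (U : eqType) (Z : seq U) (y : U) (G : U -> nat) :
  uniq Z -> \sum_(z <- Z) (y == z) * G z = (y \in Z) * G y.
Proof.
elim: Z => [|z Z IH] /=; first by rewrite big_nil.
case/andP => zZ uZ; rewrite big_cons IH // in_cons.
by case: eqP => [->|_]; rewrite ?(negPf zZ) ?mul0n ?addn0 ?add0n.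
Qed.

Lemma count_sum (T : Type) (s : seq T) (p : pred T) :
  count p s = \sum_(i <- s) p i.
Proof. by rewrite -sum1_count big_mkcond; apply: eq_bigr => i _; case: (p i). Qed.

Lemma exchange_count (T U : Type) (s : seq T) (u : seq U) (r : T -> U -> bool) :
  \sum_(i <- s) count (r i) u = \sum_(j <- u) count (r^~ j) s.
Proof.
under eq_bigr do rewrite count_sum; rewrite exchange_big /=.
by apply: eq_bigr => j _; rewrite count_sum.
Qed.

Definition reps (T U : eqType) (f : T -> U) (s : seq T) (z : U) : nat :=
  count (fun i => f i == z) s.

Lemma sum_reps (T U : eqType) (f : T -> U) (s : seq T) (Z : seq U) (G : U -> nat) :
  uniq Z -> \sum_(z <- Z) reps f s z * G z = \sum_(i <- s | f i \in Z) G (f i).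
Proof.
move=> uZ; under eq_bigr do rewrite /reps count_sum big_distrl /=.
rewrite exchange_big /= [RHS]big_mkcond /=; apply: eq_bigr => i _.
by rewrite sum_eq_uniq //; case: (f i \in Z); rewrite ?mul1n.
Qed.

Lemma sum_reps_sub (T U : eqType) (f : T -> U) (s : seq T) (Z : seq U) (G : U -> nat) :
  uniq Z -> {in s, forall i, f i \in Z} ->
  \sum_(z <- Z) reps f s z * G z = \sum_(i <- s) G (f i).
Proof.
move=> uZ sZ; rewrite sum_reps // [LHS]big_seq_cond [RHS]big_seq.
by apply: eq_bigl => i; case: (boolP (i \in s)) => //= /sZ ->.
Qed.

Lemma leq_sum_seq (T : eqType) (s : seq T) (a b : T -> nat) :
  {in s, forall i, a i <= b i} -> \sum_(i <- s) a i <= \sum_(i <- s) b i.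
Proof. by move=> ab; rewrite big_seq [leqRHS]big_seq; apply: leq_sum. Qed.

Lemma sum_const_seq (T : Type) (s : seq T) c : \sum_(i <- s) c = size s * c.
Proof. by rewrite big_const_seq count_predT iter_addn_0 mulnC. Qed.

Lemma leq_of_sqr x y : x ^ 2 <= y ^ 2 -> x <= y.
Proof. by rewrite leq_exp2r. Qed.

Lemma leq_expn2r e x y : x <= y -> x ^ e <= y ^ e.
Proof. by case: e => // e xy; rewrite leq_exp2r. Qed.

Lemma cauchy_schwarz (T : Type) (s : seq T) (a b : T -> nat) :
  (\sum_(i <- s) a i * b i) ^ 2
    <= (\sum_(i <- s) a i ^ 2) * (\sum_(i <- s) b i ^ 2).
Proof.
elim: s => [|i s IH]; first by rewrite !big_nil.
rewrite !big_cons; move: (\sum_(j <- s) a j * b j) (\sum_(j <- s) a j ^ 2)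
  (\sum_(j <- s) b j ^ 2) (a i) (b i) IH => U A B x y IH.
have h : 2 * (x * y * U) <= x ^ 2 * B + A * y ^ 2.
  apply: leq_of_sqr; apply: (@leq_trans (4 * (x * y) ^ 2 * (A * B))).
    rewrite (_ : (2 * (x * y * U)) ^ 2 = 4 * (x * y) ^ 2 * U ^ 2); last by ring.
    by rewrite leq_mul2l IH orbT.
  have /= := nat_AGM2 (x ^ 2 * B) (A * y ^ 2); case=> + _.
  by rewrite (_ : 4 * (x ^ 2 * B * (A * y ^ 2)) = 4 * (x * y) ^ 2 * (A * B)); last ring.
nia.
Qed.

Lemma cauchy_schwarz_size (T : Type) (s : seq T) (a : T -> nat) :
  (\sum_(i <- s) a i) ^ 2 <= size s * \sum_(i <- s) a i ^ 2.
Proof.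
have := cauchy_schwarz s (fun=> 1) a.
by rewrite sum_const_seq muln1; under eq_bigr do rewrite mul1n.
Qed.

Lemma nat_AGM3 x y z : 27 * (x * y * z) <= (x + y + z) ^ 3.
Proof.
have h : (forall x y z : int, 0 <= x -> 0 <= y -> 0 <= z ->
  27 * (x * y * z) <= (x + y + z) ^+ 3)%R.
  move=> {}x {}y {}z x0 y0 z0.
  have sq (t u v : int) : (0 <= t -> 0 <= t * (u - v) ^+ 2)%R.
    by move=> t0; rewrite mulr_ge0 // sqr_ge0.
  (* The difference of the two sides is 1/2 of the sum of the six terms [t * (u - v) ^+ 2] with [t]
     among [u], [v], plus 7/2 of the sum of the other three. *)
  have := sq x x y x0; have := sq x y z x0; have := sq x x z x0.
  have := sq y x y y0; have := sq y y z y0; have := sq y x z y0.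
  have := sq z x y z0; have := sq z y z z0; have := sq z x z z0.
  by nia.
have := h (Posz x) (Posz y) (Posz z) isT isT isT.
by rewrite -!PoszD -!PoszM -!rmorphXn.
Qed.

Lemma leq_of_cube x y : x ^ 3 <= y ^ 3 -> x <= y.
Proof. by rewrite leq_exp2r. Qed.

(** Hoelder's inequality with three exponents 3, cubed to avoid roots; [N] carries a factor that
    cannot be divided out in [nat]. In the induction, the cross terms of [(v + U) ^ 3] are bounded
    by the arithmetic-geometric mean inequality for three numbers. *)
Lemma holder3 (T : eqType) (s : seq T) (N : nat) (u a b c : T -> nat) :
  {in s, forall i, N * u i ^ 3 <= a i * b i * c i} ->
  N * (\sum_(i <- s) u i) ^ 3
    <= (\sum_(i <- s) a i) * (\sum_(i <- s) b i) * (\sum_(i <- s) c i).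
Proof.
elim: s => [|i s IH] h; first by rewrite !big_nil exp0n ?muln0.
have {}IH := IH (fun j js => h j (mem_behead (s := i :: s) js)).
have {}h := h i (mem_head _ _).
rewrite !big_cons; move: IH h.
move: (\sum_(j <- s) u j) (\sum_(j <- s) a j) (\sum_(j <- s) b j)
  (\sum_(j <- s) c j) (u i) (a i) (b i) (c i) => U A B C v x y z IH h.
have agm k l m w : N ^ 3 * w ^ 3 <= k * l * m -> 3 * (N * w) <= k + l + m.
  move=> hw; apply: leq_of_cube; apply: leq_trans (nat_AGM3 k l m).
  by rewrite !expnMn leq_mul2l.
have h1 : 3 * (N * (v ^ 2 * U)) <= x * y * C + x * B * z + A * y * z.
  apply: agm.
  rewrite (_ : x * y * C * (x * B * z) * (A * y * z)
    = (x * y * z) * (x * y * z) * (A * B * C)); last by ring.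
  rewrite (_ : N ^ 3 * (v ^ 2 * U) ^ 3 = (N * v ^ 3) * (N * v ^ 3) * (N * U ^ 3));
    last by ring.
  exact: leq_mul (leq_mul h h) IH.
have h2 : 3 * (N * (v * U ^ 2)) <= A * B * z + A * y * C + x * B * C.
  apply: agm.
  rewrite (_ : A * B * z * (A * y * C) * (x * B * C)
    = (A * B * C) * (A * B * C) * (x * y * z)); last by ring.
  rewrite (_ : N ^ 3 * (v * U ^ 2) ^ 3 = (N * U ^ 3) * (N * U ^ 3) * (N * v ^ 3));
    last by ring.
  exact: leq_mul (leq_mul IH IH) h.
rewrite (_ : N * (v + U) ^ 3 = N * v ^ 3 + 3 * (N * (v ^ 2 * U))
   + 3 * (N * (v * U ^ 2)) + N * U ^ 3); last by ring.
rewrite (_ : (x + A) * (y + B) * (z + C) = x * y * z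
   + (x * y * C + x * B * z + A * y * z)
   + (A * B * z + A * y * C + x * B * C) + A * B * C); last by ring.
exact: leq_add (leq_add (leq_add h h1) h2) IH.
Qed.

(** Dyadic decomposition: if [2 ^ j <= f z < 2 ^ j.+1] then [f z ^ 3 <= 8 * (2 ^ j) ^ 3], and only
    the [l] levels [j < l] occur. *)
Lemma dyadic_cube_sum (U : Type) (Z : seq U) (f : U -> nat) l D W :
  (forall z, f z < 2 ^ l) ->
  (forall t, 0 < t -> D * (t ^ 3 * count (fun z => t <= f z) Z) <= W) ->
  D * \sum_(z <- Z) f z ^ 3 <= 8 * l * W.
Proof.
move=> fl hW.
have hz z : f z ^ 3 <= \sum_(j < l) 8 * ((2 ^ j) ^ 3 * (2 ^ j <= f z)).
  have [->//|f0] := posnP (f z).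
  have /andP[h1 h2] := trunc_log_bounds (isT : 1 < 2) f0.
  have jl : trunc_log 2 (f z) < l.
    by rewrite -(ltn_exp2l _ _ (isT : 1 < 2)); apply: leq_ltn_trans (fl z).
  rewrite (bigD1 (Ordinal jl)) //= h1 muln1; apply: leq_trans (leq_addr _ _).
  by rewrite -(expnMn 2 _ 3) -expnS leq_exp2r // ltnW.
apply: leq_trans (leq_mul (leqnn D) (leq_sum _ (fun z _ => hz z))) _.
rewrite exchange_big /= (_ : 8 * l * W = \sum_(j < l) 8 * W); last first.
  by rewrite sum_nat_const card_ord; ring.
rewrite big_distrr /=; apply: leq_sum => j _.
rewrite -!big_distrr /= -count_sum mulnCA leq_mul2l /=.
by apply: hW; rewrite expn_gt0.
Qed.

Lemma count_inj_leq (T U : eqType) (s : seq T) (t : seq U) (p : pred T) (f : T -> U) :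
  uniq s -> {in s &, injective f} -> {in s, forall x, p x -> f x \in t} ->
  count p s <= size t.
Proof.
move=> us finj fp; rewrite -size_filter -(size_map f); apply: uniq_leq_size.
  rewrite map_inj_in_uniq ?filter_uniq // => x y.
  by rewrite !mem_filter => /andP[_ xs] /andP[_ ys]; apply: finj.
by move=> _ /mapP[x + ->]; rewrite mem_filter => /andP[px /fp]; apply.
Qed.

(** With [f] the product or the sum on the pairs of a set, this is its multiplicative or additive
    energy. *)
Definition energy (T U : eqType) (f : T -> U) (s : seq T) : nat :=
  \sum_(i <- s) reps f s (f i).

Lemma energy_reps (T U : eqType) (f : T -> U) (s : seq T) (Z : seq U) :
  uniq Z -> {in s, forall i, f i \in Z} ->
  \sum_(z <- Z) reps f s z ^ 2 = energy f s.
Proof. by move=> uZ sZ; rewrite /energy -(sum_reps_sub _ uZ sZ). Qed.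

Lemma energy_geq (T U : eqType) (f : T -> U) (s : seq T) (Z : seq U) :
  uniq Z -> {in s, forall i, f i \in Z} -> size s ^ 2 <= size Z * energy f s.
Proof.
move=> uZ sZ; rewrite -(energy_reps uZ sZ).
have := sum_reps_sub (fun=> 1) uZ sZ; rewrite sum_const_seq muln1 => <-.
by under eq_bigr do rewrite muln1; apply: cauchy_schwarz_size.
Qed.

Lemma coincidences_leq (T U : eqType) (f g : T -> U) (s : seq T) :
  (\sum_(i <- s) reps g s (f i)) ^ 2 <= energy f s * energy g s.
Proof.
pose Z := undup (map f s ++ map g s).
have uZ : uniq Z by apply: undup_uniq.
have fZ : {in s, forall i, f i \in Z}.
  by move=> i si; rewrite mem_undup mem_cat map_f.
have gZ : {in s, forall i, g i \in Z}.
  by move=> i si; rewrite mem_undup mem_cat map_f ?orbT.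
rewrite -(energy_reps uZ fZ) -(energy_reps uZ gZ) -(sum_reps_sub _ uZ fZ).
exact: cauchy_schwarz.
Qed.

(** * Incidences with cartesian products *)

(** At most [m] points are alone in their cell, one per cell; every other point contributes at least
    1 to the sum. *)
Lemma cell_pairs (U : eqType) (P : seq U) (h : U -> nat) m :
  uniq P -> {in P, forall x, h x < m} ->
  size P <= m + \sum_(x <- P) count (fun y => (y != x) && (h y == h x)) P.
Proof.
move=> uP hm; pose c x := count (fun y => (y != x) && (h y == h x)) P.
pose Q := [seq x <- P | c x == 0].
have Qm : size Q <= m.
  rewrite -(size_iota 0 m) -(size_map h Q); apply: uniq_leq_size.
    rewrite map_inj_in_uniq ?filter_uniq // => x y.
    rewrite !mem_filter => /andP[cx xP] /andP[_ yP] hxy; apply/eqP.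
    apply: contraT => xy; move: cx; rewrite -leqn0 leqNgt -has_count.
    by case/hasP; exists y => //; rewrite eq_sym xy hxy eqxx.
  by move=> _ /mapP[x + ->]; rewrite mem_filter mem_iota => /andP[_ /hm].
rewrite -(count_predC (fun x => c x == 0)) -size_filter leq_add //.
by rewrite count_sum; apply: leq_sum => x _ /=; rewrite -/(c x); case: (c x).
Qed.

Section Incidences.
Variable F : realFieldType.
Implicit Types (s B T : seq F) (x y : F) (l : F * F) (L : seq (F * F)).

(** Dividing the rank by a width cuts [s] into intervals without sorting it. *)
Definition rank s x : nat := count (fun y => y < x)%R s.

Lemma rank_le s x y : (x <= y)%R -> rank s x <= rank s y.
Proof. by move=> xy; apply: sub_count => z /= zx; apply: lt_le_trans zx xy. Qed.

Lemma rank_lt s x y : x \in s -> (x < y)%R -> rank s x < rank s y.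
Proof.
move=> xs xy; apply: (@leq_trans (count (predU (fun z => z < x)%R (pred1 x)) s)).
  have := count_predUI (fun z => z < x)%R (pred1 x) s.
  rewrite [count (predI _ _) _](_ : _ = 0) ?addn0 => [->|].
    by rewrite -addn1 leq_add2l -has_count has_pred1.
  apply/eqP; rewrite -leqn0 leqNgt -has_count; apply/hasPn => z _ /=.
  by apply/negP => /andP[+ /eqP zx]; rewrite zx ltxx.
by apply: sub_count => z /= /orP[zx|/eqP->//]; apply: lt_trans xy.
Qed.

Lemma rank_size s x : x \in s -> rank s x < size s.
Proof.
move=> xs; rewrite ltn_neqAle count_size andbT -all_count.
by apply/allPn; exists x => //; rewrite ltxx.
Qed.

Lemma rank_block s w j : uniq s -> 0 < w ->
  count (fun y => rank s y %/ w == j) s <= w.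
Proof.
move=> us w0; rewrite -size_filter -(size_map (rank s)) -[leqRHS](size_iota (j * w)).
apply: uniq_leq_size.
  rewrite map_inj_in_uniq ?filter_uniq // => x y.
  rewrite !mem_filter => /andP[_ xs] /andP[_ ys] xy.
  by case: (ltgtP x y) => // /rank_lt; [move/(_ s xs)|move/(_ s ys)]; rewrite xy ltnn.
move=> _ /mapP[x + ->]; rewrite mem_filter => /andP[/eqP <- _].
by rewrite mem_iota leq_divM /= -mulSnr; apply: ltn_ceil.
Qed.

Definition line l x : F := (l.1 * x + l.2)%R.

(* Cut [B] and [T] into [k] intervals each.  A line of positive slope meets
   fewer than [2 k] of the [k ^ 2] cells, so all but [2 k] of its points share a
   cell with another of its points; two points lie on one common line only. *)
Lemma incidence_bound B T L k : uniq B -> uniq T -> uniq L ->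
  {in L, forall l, 0 < l.1}%R -> 0 < k -> k <= size B -> k <= size T ->
  k ^ 2 * \sum_(l <- L) count (fun x => line l x \in T) B
    <= 2 * k ^ 3 * size L + 4 * (size B * size T) ^ 2.
Proof.
move=> uB uT uL Lpos k0 kB kT.
pose wB := (size B %/ k).+1; pose wT := (size T %/ k).+1.
have small s : k <= size s -> k * (size s %/ k).+1 <= 2 * size s.
  by move=> ks; rewrite mulnSr mulnC; have := leq_divM (size s) k; lia.
have cell_lt s x : x \in s -> rank s x %/ (size s %/ k).+1 < k.
  move=> xs; rewrite ltn_divLR //; apply: leq_trans (rank_size xs) _.
  by rewrite mulnC ltnW // ltn_ceil.
pose iB x := rank B x %/ wB; pose jT x := rank T x %/ wT.
(* Along a line of positive slope both indices are nondecreasing, so equal sums at two points force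
   both indices to agree. The sum thus labels the cells met by the line, and it stays below
   [2 * k]. *)
pose h l x := iB x + jT (line l x).
pose pts l := [seq x <- B | line l x \in T].
pose same l x y := [&& y != x, iB y == iB x, line l x \in T, line l y \in T
                     & jT (line l y) == jT (line l x)].
have line_cells l : l \in L -> count (fun x => line l x \in T) B
    <= 2 * k + \sum_(x <- B) count (same l x) B.
  move=> lL; rewrite -size_filter -/(pts l).
  have hlt : {in pts l, forall x, h l x < 2 * k}.
    move=> x; rewrite mem_filter => /andP[lxT xB].
    have := cell_lt _ _ xB; have := cell_lt _ _ lxT.
    by rewrite /h /iB /jT /wB /wT; lia.
  have := cell_pairs (filter_uniq _ uB) hlt => /leq_trans; apply.
  rewrite leq_add2l big_filter big_mkcond; apply: leq_sum => x _.
  case: ifP => // lxT; rewrite count_filter; apply: sub_count => y /=.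
  case/andP=> /andP[yx /eqP hxy] lyT; rewrite /same yx lxT lyT /=.
  suff [-> ->] : iB y = iB x /\ jT (line l y) = jT (line l x) by rewrite !eqxx.
  wlog xy : x y yx lxT lyT hxy / (x < y)%R.
    move=> H; case: (ltgtP x y) => [xy|xy|exy]; first exact: H.
      by case: (H y x) => //; rewrite eq_sym.
    by rewrite exy eqxx in yx.
  have h1 : iB x <= iB y by apply/leq_div2r/rank_le/ltW.
  have h2 : jT (line l x) <= jT (line l y).
    apply/leq_div2r/rank_le; rewrite lerD2r ler_wpM2l // ltW //.
    exact: Lpos.
  by move: hxy; rewrite /h; lia.
(* For [y != x], a line is determined by its values at [x] and [y]; as these lie in one block of
   [T], there are at most [size T * wT] choices. *)
have pairs_lines x y : x \in B ->
    \sum_(l <- L) same l x y <= (iB y == iB x) * (size T * wT).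
  move=> xB; rewrite -count_sum.
  have [yx|yx] := eqVneq y x; first by rewrite [count _ _](_ : _ = 0) // -(count_pred0 L);
    apply: eq_count => l; rewrite /same yx eqxx.
  case: eqP => ixy; last first.
    by rewrite mul0n leqn0 -(count_pred0 L); apply/eqP/eq_count => l;
       rewrite /same; move/eqP/negPf: ixy ->; rewrite andbF.
  rewrite mul1n -size_filter -(size_map (fun l => (line l x, line l y))).
  apply: (@leq_trans (size [seq (t, t') | t <- T, t' <- [seq t' <- T | jT t' == jT t]])).
    apply: uniq_leq_size.
      rewrite map_inj_in_uniq ?filter_uniq // => -[a b] [a' b'] _ _ [] /=.
      rewrite /line /= => e1 e2.
      have : ((a - a') * (x - y)
        = (a * x + b - (a' * x + b')) - (a * y + b - (a' * y + b')))%R by ring.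
      rewrite e1 e2 !subrr => /eqP; rewrite mulf_eq0 !subr_eq0.
      rewrite [x == y]eq_sym (negPf yx) orbF => /eqP aa.
      by move: e1; rewrite aa => /addrI ->.
    move=> _ /mapP[l + ->]; rewrite mem_filter => /andP[/and5P[_ _ lx ly jj] _].
    by apply/allpairsPdep; exists (line l x), (line l y); rewrite mem_filter jj.
  rewrite size_allpairs_dep sumnE big_map -sum_const_seq.
  by apply: leq_sum => t _; rewrite size_filter rank_block.
have tot : \sum_(l <- L) count (fun x => line l x \in T) B
    <= 2 * k * size L + (size B * wB) * (size T * wT).
  apply: leq_trans (leq_sum_seq line_cells) _.
  rewrite big_split /= sum_const_seq mulnC leq_add2l exchange_big /=.
  rewrite -mulnA -[leqRHS]sum_const_seq; apply: leq_sum_seq => x xB.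
  under eq_bigr do rewrite count_sum; rewrite exchange_big /=.
  apply: leq_trans (leq_sum _ (fun y _ => pairs_lines x y xB)) _.
  rewrite -big_distrl -count_sum leq_mul2r; apply/orP; right.
  exact: rank_block.
apply: leq_trans (leq_mul (leqnn _) tot) _; rewrite mulnDr; apply: leq_add.
  by rewrite leq_eqVlt; apply/orP; left; apply/eqP; ring.
have := leq_mul (leq_mul (leqnn (size B * size T)) (small B kB)) (small T kT).
rewrite -/wB -/wT; generalize wB wT => u v.
by congr (_ <= _); ring.
Qed.

(** The Szemeredi-Trotter bound for lines with at least [u / v] points on average. With [k] about
    [u / (4 * v)], the [2 * k] points per line make up at most half of the incidences, and the pairs
    sharing a cell must account for the rest. Rounding [k] costs a factor 2, whence
    [512 = 8 * 8 ^ 2]. *)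
Lemma incidence_average B T L u v : uniq B -> uniq T -> uniq L ->
  {in L, forall l, 0 < l.1}%R -> 0 < v -> 4 * v <= u ->
  u <= 4 * v * size B -> u <= 4 * v * size T ->
  u * size L <= v * \sum_(l <- L) count (fun x => line l x \in T) B ->
  u ^ 3 * size L <= 512 * v ^ 3 * (size B * size T) ^ 2.
Proof.
move=> uB uT uL Lpos v0 vu uvB uvT; set I := \sum_(l <- L) _ => LI.
have v4 : 0 < 4 * v by rewrite muln_gt0.
pose k := u %/ (4 * v).
have k0 : 0 < k by rewrite divn_gt0.
have kB : k <= size B by rewrite -(mulKn (size B) v4) leq_div2r.
have kT : k <= size T by rewrite -(mulKn (size T) v4) leq_div2r.
have := incidence_bound uB uT uL Lpos k0 kB kT; rewrite -/I.
have k1 : k * (4 * v) <= u := leq_divM _ _.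
have k2 : u <= 8 * v * k.
  have : u < k.+1 * (4 * v) := ltn_ceil _ v4.
  by have := leq_mul k0 (leqnn (4 * v)); generalize k; lia.
move: LI k1 k2; generalize (size L) ((size B * size T) ^ 2) I k.
clear k0 kB kT; clear k I => N W I k LI k1 k2 h.
have h1 : k ^ 2 * (u * N) <= 8 * v * W.
  have h2 := leq_mul (leqnn (k ^ 2)) LI.
  have h3 := leq_mul (leqnn v) h.
  have h4 := leq_mul (leqnn (k ^ 2 * N)) k1.
  rewrite (_ : k ^ 2 * (v * I) = v * (k ^ 2 * I)) in h2; last by ring.
  rewrite (_ : v * (2 * k ^ 3 * N + 4 * W) = 2 * (v * k ^ 3 * N) + 4 * (v * W)) in h3;
    last by ring.
  rewrite (_ : k ^ 2 * N * (k * (4 * v)) = 4 * (v * k ^ 3 * N)) in h4; last by ring.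
  rewrite (_ : k ^ 2 * N * u = k ^ 2 * (u * N)) in h4; last by ring.
  by rewrite -mulnA; lia.
have h2 : u ^ 2 <= (8 * v * k) ^ 2 by rewrite leq_exp2r.
rewrite (_ : u ^ 3 * N = u ^ 2 * (u * N)); last by ring.
apply: leq_trans (leq_mul h2 (leqnn _)) _.
rewrite (_ : (8 * v * k) ^ 2 * (u * N) = 64 * v ^ 2 * (k ^ 2 * (u * N))); last by ring.
apply: leq_trans (leq_mul (leqnn _) h1) _.
by rewrite leq_eqVlt; apply/orP; left; apply/eqP; ring.
Qed.
End Incidences.

(** * Third moments and energies *)

Local Notation pairs A B := [seq (a, b) | a <- A, b <- B].

Section Moments.
Variable F : realFieldType.
Implicit Types A B T X : seq F.

(** The lines with at least [t] points are counted by [incidence_average] if [t >= 4], and by the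
    bound on the total number of incidences if [t < 4]. *)
Lemma line_third_moment A (Z : seq (F * F)) l :
  uniq A -> uniq Z -> {in Z, forall z, 0 < z.1}%R -> size A < 2 ^ l ->
  \sum_(z <- Z) count (fun x => line z x \in A) A <= size A ^ 4 ->
  \sum_(z <- Z) count (fun x => line z x \in A) A ^ 3
    <= 8 * l * (512 * size A ^ 4).
Proof.
move=> uA uZ Zpos Al Zsum; pose m z := count (fun x => line z x \in A) A.
rewrite -[leqLHS]mul1n; apply: dyadic_cube_sum => [z|t t0].
  exact: leq_ltn_trans (count_size _ _) Al.
rewrite mul1n -size_filter -/(m _); set L := filter _ Z.
have Lt : t * size L <= \sum_(z <- L) m z.
  by rewrite mulnC -sum_const_seq; apply: leq_sum_seq => z; rewrite mem_filter => /andP[].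
have [t4|t4] := leqP 4 t.
  have [->|[z0]] : L = [::] \/ exists z, z \in L.
    by case: (L) => [|z s]; [left | right; exists z; rewrite mem_head].
    by rewrite muln0.
  rewrite mem_filter => /andP[tz _].
  have tA : t <= size A := leq_trans tz (count_size _ _).
  have := @incidence_average F A A L t 1 uA uA (filter_uniq _ uZ).
  rewrite (_ : size A * size A = size A ^ 2) ?mul1n ?muln1 -?expnM //.
  apply => //; try lia.
  by move=> z; rewrite mem_filter => /andP[_ /Zpos].
have : \sum_(z <- L) m z <= size A ^ 4.
  apply: leq_trans Zsum; rewrite big_filter big_mkcond; apply: leq_sum => z _.
  by case: ifP.
move=> /(leq_trans Lt) /(leq_mul (leqnn (t ^ 2))).
rewrite mulnA -expnSr => /leq_trans; apply; rewrite leq_mul2r; apply/orP; right.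
by apply: (@leq_trans (4 ^ 2)); rewrite ?leq_exp2r // ltnW.
Qed.

(** Let [x] have at least [t] representations. For each [b] with [x + b] in [A'], at least [d]
    elements [c] of [A] put [c * (x + b)] in [T]. Hence the [size A] lines of slope [c] and
    intercept [c * x] together contain at least [t * d] points of [B * T]. *)
Lemma diff_third_moment A A' B T X d l :
  uniq A -> uniq A' -> uniq B -> uniq T -> uniq X ->
  {in A, forall a, 0 < a}%R -> {subset A' <= A} -> size A < 2 ^ l ->
  size A' <= size B -> 0 < d ->
  {in A', forall a, d <= count (fun c => (c * a)%R \in T) A} ->
  d ^ 3 * \sum_(x <- X) count (fun b => (x + b)%R \in A') B ^ 3
    <= 8 * l * (512 * (size A * size B * size T) ^ 2).
Proof.
move=> uA uA' uB uT uX Apos A'A Al A'B d0 dA'.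
pose r x := count (fun b => (x + b)%R \in A') B.
have sA' : size A' <= size A by apply: uniq_leq_size.
have rA' x : r x <= size A'.
  by apply: (@count_inj_leq _ _ _ _ _ (fun b => x + b)%R) => // b b' _ _ /addrI.
apply: dyadic_cube_sum => [x|t t0].
  exact: leq_ltn_trans (leq_trans (rA' x) sA') Al.
rewrite -size_filter -/(r _); set Xt := filter _ X.
have [->|[x0 x0X]] : Xt = [::] \/ exists x, x \in Xt.
  by case: (Xt) => [|x s]; [left | right; exists x; rewrite mem_head].
  by rewrite !muln0.
have rt x : x \in Xt -> t <= r x by rewrite mem_filter => /andP[].
have tr := rt _ x0X.
have [a0 a0A'] : exists a, a \in A'.
  have : 0 < r x0 by apply: leq_trans tr.
  by rewrite -has_count => /hasP[b _ ?]; exists (x0 + b)%R.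
have tA : t <= size A by apply: leq_trans tr (leq_trans (rA' _) sA').
have tB : t <= size B by apply: leq_trans tr (count_size _ _).
have dA : d <= size A := leq_trans (dA' _ a0A') (count_size _ _).
have dT : d <= size T.
  apply: leq_trans (dA' _ a0A') _.
  apply: (@count_inj_leq _ _ _ _ _ (fun c => c * a0)%R) => //.
  by move=> c c' _ _ /mulIf; apply; rewrite gt_eqF // Apos // A'A.
have A0 : 0 < size A by apply: leq_trans dA.
have [td|td] := leqP (4 * size A) (t * d).
  pose L := [seq (c, (c * x)%R) | x <- Xt, c <- A].
  have sL : size L = size Xt * size A by rewrite size_allpairs.
  have := @incidence_average F B T L (t * d) (size A) uB uT.
  rewrite sL => H.
  have {}H : (t * d) ^ 3 * (size Xt * size A) <= 512 * size A ^ 3 * (size B * size T) ^ 2.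
    apply: H => //.
    - apply: allpairs_uniq; [exact: filter_uniq|by []|].
      move=> _ _ /allpairsP[[x c] [_ cA ->]] /allpairsP[[x' c'] [_ c'A ->]] /= [<-].
      by move/mulfI => -> //; rewrite gt_eqF ?Apos.
    - by move=> _ /allpairsP[[x c] [_ cA ->]] /=; apply: Apos.
    - by have := leq_mul tB dA; lia.
    - by have := leq_mul tA dT; lia.
    rewrite mulnA mulnC leq_mul2l; apply/orP; right.
    rewrite /L big_allpairs_dep /= mulnC -sum_const_seq.
    apply: leq_sum_seq => x /rt tx.
    rewrite exchange_count.
    apply: (@leq_trans (\sum_(b <- B | (x + b)%R \in A') d)).
      by rewrite big_const_seq iter_addn_0 [t * d]mulnC leq_mul2l tx orbT.
    rewrite big_mkcond; apply: leq_sum => b _; case: ifP => // /dA' /leq_trans; apply.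
    by apply: sub_count => c; rewrite /line /= -mulrDr addrC.
  rewrite -(leq_pmul2r A0); apply: leq_trans (leq_trans H _);
    by rewrite leq_eqVlt; apply/orP; left; apply/eqP; ring.
(* If [t * d < 4 * size A], the lines are too poor for [incidence_average], and the trivial count of
   all representations suffices. *)
have tX : t * size Xt <= size A' * size B.
  rewrite mulnC -sum_const_seq.
  apply: leq_trans (leq_sum_seq rt) _.
  apply: (@leq_trans (\sum_(x <- X) r x)).
    by rewrite big_filter big_mkcond; apply: leq_sum => z _; case: ifP.
  rewrite exchange_count mulnC -sum_const_seq; apply: leq_sum => b _.
  by apply: (@count_inj_leq _ _ _ _ _ (fun x => x + b)%R) => // x x' _ _ /addIr.
have h1 : (t * d) ^ 2 <= 16 * size A ^ 2.
  by rewrite -[16]/(4 ^ 2) -expnMn leq_exp2r // ltnW.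
have h2 : d * (t * size Xt) <= size T * (size B * size B).
  by apply: leq_mul dT (leq_trans tX _); rewrite leq_mul2r A'B orbT.
have h3 : size T <= size T ^ 2 by rewrite -mulnn leq_pmulr // (leq_trans d0).
rewrite (_ : d ^ 3 * (t ^ 3 * size Xt) = (t * d) ^ 2 * (d * (t * size Xt))); last by ring.
apply: leq_trans (leq_mul h1 (leq_trans h2 (leq_mul h3 (leqnn _)))) _.
rewrite (_ : _ * (size T ^ 2 * _) = 16 * (size A * size B * size T) ^ 2); last by ring.
by rewrite leq_mul2r orbT.
Qed.

Lemma reps_pairs (U : eqType) (f : F * F -> U) A B z :
  reps f (pairs A B) z = \sum_(a <- A) \sum_(b <- B) (f (a, b) == z).
Proof. by rewrite /reps count_sum big_allpairs. Qed.

Lemma energy_pairs (U : eqType) (f : F * F -> U) A B :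
  energy f (pairs A B) = \sum_(a <- A) \sum_(b <- B) \sum_(c <- A) \sum_(d <- B)
    (f (c, d) == f (a, b)).
Proof.
rewrite /energy big_allpairs; apply: eq_bigr => a _; apply: eq_bigr => b _.
exact: reps_pairs.
Qed.

(** Both energies count quadruples, and [b] and [d] are exchanged: [c * d = a * b] becomes
    [c / b = a / d], and likewise sums become differences. *)
Lemma energy_swap (U V : eqType) (f : F * F -> U) (g : F * F -> V) A :
  {in A & A, forall a b, {in A & A, forall c d,
    (f (c, d) == f (a, b)) = (g (c, b) == g (a, d))}} ->
  energy f (pairs A A) = energy g (pairs A A).
Proof.
move=> fg; rewrite !energy_pairs; apply: eq_big_seq => a aA.
rewrite [RHS]exchange_big; under [RHS]eq_bigr do rewrite exchange_big.
rewrite [RHS]exchange_big; apply: eq_big_seq => b bA /=.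
apply: eq_big_seq => c cA; apply: eq_big_seq => d dA; by rewrite fg.
Qed.

Lemma sum_mem_uniq (A : seq F) x : uniq A -> \sum_(a <- A) (a == x) = (x \in A).
Proof. by move=> uA; rewrite -count_sum count_uniq_mem. Qed.

Lemma reps_sub A B x : uniq A ->
  reps (fun p => p.1 - p.2)%R (pairs A B) x = count (fun b => (x + b)%R \in A) B.
Proof.
move=> uA; rewrite reps_pairs exchange_big count_sum; apply: eq_bigr => b _ /=.
by rewrite -(sum_mem_uniq _ uA); apply: eq_bigr => a _; rewrite subr_eq.
Qed.

Lemma mul_energy_lower A P l : uniq A -> uniq P -> {in A, forall a, 0 < a}%R ->
  size A < 2 ^ l ->
  {in A, forall a, {in A & A, forall b c, (a * (b + c))%R \in P}} ->
  size A ^ 6 <= 8 * 512 * l * size P ^ 2 * energy (fun p => p.1 * p.2)%R (pairs A A).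
Proof.
move=> uA uP Apos Al AP; set E := energy _ _.
have [->//|n0] := posnP (size A); set n := size A in n0 *.
pose A2 := pairs A A; have sA2 : size A2 = n ^ 2 by rewrite size_allpairs mulnn.
pose quot (p : F * F) := (p.1 / p.2)%R.
have EE : energy quot A2 = E.
  apply: energy_swap => a b /Apos a0 /Apos b0 c d /Apos c0 /Apos d0 /=.
  by rewrite /quot /= eqr_div // gt_eqF.
pose m z := count (fun x => line z x \in A) A.
(* [phi q x] is the intercept of the line of slope [q] through [x], so [m (q, phi q x)] counts the
   points of [A * A] on that line. *)
pose phi q (x : F * F) := (x.2 - q * x.1)%R.
have reps_phi q y : reps (phi q) A2 y = m (q, y).
  rewrite reps_pairs /m count_sum; apply: eq_bigr => b _ /=.
  rewrite -(sum_mem_uniq _ uA); apply: eq_bigr => b' _.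
  by rewrite /phi /line /= subr_eq addrC.
(* With points [(b, b')] and [(c, c')], this counts the solutions of [b' + c' = q * (b + c)].
   Cauchy-Schwarz removes the sign, as [- phi q] has the same energy as [phi q]. *)
pose g q := \sum_(x <- A2) reps (fun y => - phi q y)%R A2 (phi q x).
have g_le q : g q <= \sum_(x <- A2) m (q, phi q x).
  have -> : \sum_(x <- A2) m (q, phi q x) = energy (phi q) A2.
    by apply: eq_bigr => x _; rewrite reps_phi.
  apply: leq_of_sqr; apply: leq_trans (coincidences_leq _ _ _) _.
  rewrite -mulnn leq_mul2l; apply/orP; right.
  rewrite /energy /reps; apply: leq_sum => x _; rewrite leq_eqVlt; apply/orP; left.
  by apply/eqP/eq_count => y; rewrite eqr_opp.
pose f3 (i : F * (F * F)) := (i.1 * (i.2.1 + i.2.2))%R.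
pose A3 := pairs A A2.
have N_low : (n ^ 3) ^ 2 <= size P * energy f3 A3.
  have -> : n ^ 3 = size A3 by rewrite size_allpairs sA2 expnS.
  apply: energy_geq => // _ /allpairsP[[a x] [aA + ->]].
  by case/allpairsP => -[b c] [bA cA ->]; apply: AP.
have N_quot : energy f3 A3 = \sum_(p <- A2) g (quot p).
  rewrite /energy !big_allpairs; apply: eq_big_seq => a /Apos a0.
  under eq_bigr do rewrite /reps count_sum big_allpairs.
  rewrite exchange_big /=; apply: eq_big_seq => a' /Apos a'0.
  rewrite /g !big_allpairs; apply: eq_bigr => b _.
  under eq_bigr do rewrite big_allpairs.
  rewrite exchange_big /=; apply: eq_bigr => b' _.
  rewrite reps_pairs; apply: eq_bigr => c _; apply: eq_bigr => c' _.
  congr nat_of_bool; rewrite /f3 /phi /quot /=.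
  have a'n : a' != 0%R by rewrite gt_eqF.
  rewrite -[LHS]subr_eq0 -[RHS]subr_eq0.
  rewrite -[RHS](mulrI_eq0 _ (mulfI a'n)) -[LHS]oppr_eq0; congr (_ == 0)%R.
  by field.
pose Q := undup (map quot A2).
have uQ : uniq Q by apply: undup_uniq.
have A2Q : {in A2, forall p, quot p \in Q}.
  by move=> p pA; rewrite mem_undup map_f.
(* [psi] sends a slope and a point to the line of that slope through the point. A line [z] arises
   from [m z] points, so the second moment of [m] over [ps] is its third moment over lines. *)
pose ps := pairs Q A2; pose psi (i : F * (F * F)) := (i.1, phi i.1 i.2).
have N_ps : energy f3 A3 <= \sum_(i <- ps) reps quot A2 i.1 * m (psi i).
  rewrite N_quot -(sum_reps_sub _ uQ A2Q) big_allpairs; apply: leq_sum => q _ /=.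
  by rewrite -big_distrr leq_mul2l g_le orbT.
have sum_quot : \sum_(i <- ps) reps quot A2 i.1 ^ 2 = n ^ 2 * E.
  rewrite big_allpairs -EE -(energy_reps uQ A2Q) big_distrr; apply: eq_bigr => q _.
  by rewrite /= sum_const_seq sA2.
pose Z := undup (map psi ps).
have uZ : uniq Z by apply: undup_uniq.
have psZ : {in ps, forall i, psi i \in Z} by move=> i ip; rewrite mem_undup map_f.
have reps_psi : {in Z, forall z, reps psi ps z = m z}.
  move=> z; rewrite mem_undup => /mapP[[q x] /allpairsP[[q' x'] [/= q'Q _ [qq _]]] ->].
  rewrite -{}qq in q'Q.
  rewrite /psi /=; move: (phi q x) => y.
  transitivity (\sum_(q'' <- Q) (q == q'') * reps (phi q'') A2 y); last first.
    by rewrite (sum_eq_uniq _ (fun q => reps (phi q) A2 y)) // q'Q mul1n reps_phi.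
  rewrite /reps count_sum big_allpairs; apply: eq_bigr => q'' _.
  rewrite count_sum big_distrr; apply: eq_bigr => x'' _.
  by rewrite xpair_eqE /= mulnb [q'' == q]eq_sym.
have sum_psi : \sum_(i <- ps) m (psi i) ^ 2 <= 8 * l * (512 * n ^ 4).
  rewrite -(sum_reps_sub (fun z => m z ^ 2) uZ psZ).
  under eq_big_seq => z zZ do rewrite reps_psi // -expnS.
  apply: line_third_moment => //.
    move=> z; rewrite mem_undup => /mapP[_ /allpairsP[[q x] [/= + _ ->]] ->] /=.
    rewrite mem_undup => /mapP[_ /allpairsP[[a b] [/= /Apos a0 /Apos b0 ->]] ->].
    exact: divr_gt0.
  rewrite -/(m _);
  under eq_big_seq => z zZ do rewrite -/(m z) -reps_psi // -[reps _ _ _]muln1.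
  rewrite (sum_reps_sub (fun=> 1) uZ psZ) sum_const_seq muln1 size_allpairs sA2.
  rewrite (expnD _ 2 2) leq_mul2r -sA2 -(size_map quot A2) size_undup orbT //.
have N_up : energy f3 A3 ^ 2 <= n ^ 2 * E * (8 * l * (512 * n ^ 4)).
  apply: (@leq_trans ((\sum_(i <- ps) reps quot A2 i.1 * m (psi i)) ^ 2)).
    by rewrite leq_exp2r.
  apply: leq_trans (cauchy_schwarz _ _ _) _.
  by rewrite sum_quot leq_mul2l sum_psi orbT.
have n6 : 0 < n ^ 6 by rewrite expn_gt0 n0.
rewrite -(leq_pmul2r n6).
have : ((n ^ 3) ^ 2) ^ 2 <= (size P * energy f3 A3) ^ 2 by rewrite leq_exp2r.
rewrite expnMn => h.
have {}h := leq_trans h (leq_mul (leqnn _) N_up).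
by apply: leq_trans (leq_trans _ h) _; rewrite leq_eqVlt; apply/orP; left; apply/eqP; ring.
Qed.

Lemma energy_sub_sum A B G : uniq A ->
  {in pairs A B, forall p, (p.1 - p.2)%R \in G} -> uniq G -> forall (h : F -> nat),
  \sum_(g <- G) count (fun b => (g + b)%R \in A) B * h g
    = \sum_(a <- A) \sum_(b <- B) h (a - b)%R.
Proof.
move=> uA sG uG h.
transitivity (\sum_(p <- pairs A B) h (p.1 - p.2)%R); last by rewrite big_allpairs.
rewrite -(sum_reps_sub h uG sG); apply: eq_bigr => g _.
by rewrite reps_sub.
Qed.

(* [A_x] being the set of the [b] in [A] with [x + b] in [A], the set [A + A_x]
   is contained in the set of the [s] in [S] with [x + s] in [S]. *)
Lemma sum_energy_cube A S X : uniq A -> uniq S -> uniq X ->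
  {in A & A, forall a b, (a + b)%R \in S} ->
  {in pairs A A, forall p, (p.1 - p.2)%R \in X} ->
  size A ^ 2 * energy (fun p => p.1 + p.2)%R (pairs A A) ^ 3
    <= (\sum_(x <- X) count (fun b => (x + b)%R \in A) A ^ 3) ^ 2
       * energy (fun p => p.1 - p.2)%R (pairs A S).
Proof.
move=> uA uS uX AS AX; set E := energy _ (pairs A A).
pose r x := count (fun b => (x + b)%R \in A) A.
pose q x := count (fun s => (x + s)%R \in S) S.
pose Ax x := [seq b <- A | (x + b)%R \in A].
pose e x := energy (fun p => p.1 + p.2)%R (pairs A (Ax x)).
have -> : E = \sum_(x <- X) r x ^ 2.
  rewrite /E (@energy_swap _ _ _ (fun p => p.1 - p.2)%R) => [|a b _ _ c d _ _ /=].
    by rewrite -(energy_reps uX AX); apply: eq_bigr => x _; rewrite reps_sub.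
  by rewrite -subr_eq0 -[RHS]subr_eq0; congr (_ == 0)%R; ring.
have -> : energy (fun p => p.1 - p.2)%R (pairs A S) = \sum_(x <- X) r x * q x.
  rewrite energy_sub_sum // energy_pairs; apply: eq_bigr => a _.
  rewrite exchange_big /=; apply: eq_bigr => c _.
  rewrite exchange_big /q count_sum; apply: eq_bigr => s _ /=.
  rewrite -(sum_mem_uniq _ uS); apply: eq_bigr => s' _.
  congr nat_of_bool.
  by rewrite -subr_eq0 -[RHS]subr_eq0; congr (_ == 0)%R; ring.
have r_e x : (size A * r x) ^ 2 <= q x * e x.
  pose Z := undup [seq (p.1 + p.2)%R | p <- pairs A (Ax x)].
  have -> : size A * r x = size (pairs A (Ax x)) by rewrite size_allpairs size_filter.
  apply: (@leq_trans (size Z * e x)).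
    apply: energy_geq => [|p pA]; rewrite ?undup_uniq // mem_undup.
    exact: (map_f (fun p => p.1 + p.2)%R).
  rewrite leq_mul2r; apply/orP; right; rewrite /q -size_filter.
  apply: uniq_leq_size; rewrite ?undup_uniq // => z; rewrite mem_undup.
  case/mapP => _ /allpairsP[[a b] [/= aA + ->]] ->.
  by rewrite !mem_filter => /andP[xbA bA]; rewrite addrCA !AS.
(* For fixed [a], [c] and [z = a - c], a solution requires [b], [x + b], [z + b] and [z + x + b] to
   lie in [A], which leaves at most [r z] choices for each of [b] and [x + b]. *)
have sum_e : \sum_(x <- X) e x <= \sum_(x <- X) r x ^ 3.
  under [leqRHS]eq_bigr do rewrite expnS.
  rewrite (energy_sub_sum uA AX uX (fun x => r x ^ 2)) /e.
  under eq_bigr do rewrite energy_pairs; rewrite exchange_big; apply: leq_sum => a _ /=.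
  under eq_bigr do rewrite exchange_big; rewrite exchange_big; apply: leq_sum => c _ /=.
  set z := (a - c)%R.
  have hx x b : \sum_(d <- Ax x) ((c + d)%R == (a + b)%R)
      <= ((z + b)%R \in A) && ((z + (x + b))%R \in A).
    rewrite addrCA andbC -(mem_filter (fun d => (x + d)%R \in A)).
    rewrite -(sum_mem_uniq _ (filter_uniq _ uA)).
    apply: leq_sum => d _; rewrite leq_eqVlt; apply/orP; left; apply/eqP.
    congr nat_of_bool; rewrite -subr_eq0 -[RHS]subr_eq0; congr (_ == 0)%R.
    by rewrite /z; ring.
  apply: (@leq_trans (\sum_(x <- X) \sum_(b <- A)
    ((x + b)%R \in A) * (((z + b)%R \in A) * ((z + (x + b))%R \in A)))).
    apply: leq_sum => x _; rewrite big_filter big_mkcond; apply: leq_sum => b _.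
    by case: ifP => // _; rewrite mul1n mulnb.
  rewrite exchange_big -mulnn {1}/r count_sum big_distrl /=; apply: leq_sum => b _.
  case: (_ \in A) => /=; last by rewrite big1 // => x _; rewrite mul0n muln0.
  rewrite mul1n; under eq_bigr do rewrite mul1n mulnb; rewrite -count_sum.
  rewrite /r -[leqRHS]size_filter.
  apply: (@count_inj_leq _ _ _ _ _ (fun x => x + b)%R) => //.
    by move=> x x' _ _ /addIr.
  by move=> x _ /andP[xb zxb]; rewrite mem_filter zxb xb.
apply: (@leq_trans ((\sum_(x <- X) r x ^ 3) * (\sum_(x <- X) e x)
    * (\sum_(x <- X) r x * q x))).
  (* Pointwise, [size A ^ 2 * (r x ^ 2) ^ 3 <= r x ^ 3 * e x * (r x * q x)] by [r_e]. *)
  apply: holder3 => x _.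
  rewrite (_ : size A ^ 2 * _ = r x ^ 4 * (size A * r x) ^ 2); last by ring.
  by rewrite (_ : _ * e x * _ = r x ^ 4 * (q x * e x)) ?leq_mul2l ?r_e ?orbT //; ring.
by rewrite leq_mul2r -mulnn leq_mul2l sum_e !orbT.
Qed.
End Moments.

(** * The bound for positive sets *)

(** Entries below half the average weight carry at most half of the total; the popular ones carry
    the rest, at most [m] each. *)
Lemma popular_mass (T : Type) (s : seq T) (w : T -> nat) m :
  0 < size s -> (forall i, w i <= m) ->
  \sum_(i <- s) w i
    <= 2 * m * count (fun i => \sum_(j <- s) w j <= 2 * size s * w i) s.
Proof.
move=> s0 wm; set W := \sum_(i <- s) w i; pose p i := W <= 2 * size s * w i.
have h : 2 * size s * \sum_(i <- s | ~~ p i) w i <= size s * W.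
  rewrite big_distrr big_mkcond -sum_const_seq; apply: leq_sum => i _ /=.
  by case: ifP => //; rewrite /p -ltnNge => /ltnW.
have {}h : 2 * \sum_(i <- s | ~~ p i) w i <= W.
  by rewrite -(leq_pmul2l s0) mulnA [size s * 2]mulnC.
have h' : \sum_(i <- s | p i) w i <= m * count p s.
  rewrite mulnC -size_filter -sum_const_seq big_filter; exact: leq_sum.
have arith a b c u : a = b + c -> 2 * c <= a -> b <= u -> a <= 2 * u by lia.
rewrite -mulnA; apply: arith h h'; exact: bigID.
Qed.

(** In use, [m], [s], [t] are the sizes of [A'], [S], [T]; [E] is the additive energy of [A'], [G]
    the energy of the differences [A' - S], and [E3], [E3S] the third moments for [A' - A'] and
    [A' - S]. Multiplying the hypotheses after [0 < m] with exponents 6, 2, 1, 4, 1 eliminates these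
    four quantities. *)
Lemma combine_moments m s d t n l K E E3 G E3S :
  0 < m -> m ^ 4 <= s * E -> m ^ 2 * E ^ 3 <= E3 ^ 2 * G -> G ^ 2 <= m * s * E3S ->
  d ^ 3 * E3 <= K * l * (n * m * t) ^ 2 -> d ^ 3 * E3S <= K * l * (n * s * t) ^ 2 ->
  m ^ 19 * d ^ 15 <= (K * l * (n * t) ^ 2) ^ 5 * s ^ 9.
Proof.
move=> m0 h1 h2 h3 h4 h5; have m9 : 0 < m ^ 9 by rewrite expn_gt0 m0.
rewrite -(leq_pmul2l m9).
have := leq_mul (leqnn (m ^ 4 * d ^ 15)) (leq_expn2r 6 h1).
have := leq_mul (leqnn (s ^ 6 * d ^ 15)) (leq_expn2r 2 h2).
have := leq_mul (leqnn (s ^ 6 * d ^ 15 * E3 ^ 4)) h3.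
have := leq_mul (leqnn (s ^ 7 * m)) (leq_mul (leq_expn2r 4 h4) h5).
move=> k4 k3 k2 k1.
rewrite (_ : m ^ 9 * (m ^ 19 * d ^ 15) = m ^ 4 * d ^ 15 * (m ^ 4) ^ 6); last by ring.
apply: leq_trans k1 _.
rewrite (_ : _ * (s * E) ^ 6 = s ^ 6 * d ^ 15 * (m ^ 2 * E ^ 3) ^ 2); last by ring.
apply: leq_trans k2 _.
rewrite (_ : _ * (E3 ^ 2 * G) ^ 2 = s ^ 6 * d ^ 15 * E3 ^ 4 * G ^ 2); last by ring.
apply: leq_trans k3 _.
rewrite (_ : _ * (m * s * E3S) = s ^ 7 * m * ((d ^ 3 * E3) ^ 4 * (d ^ 3 * E3S)));
  last by ring.
apply: leq_trans k4 _.
by rewrite leq_eqVlt; apply/orP; left; apply/eqP; ring.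
Qed.

(** Here [E] is the multiplicative energy and [e] the number of pairs with a popular product. Of the
    34 factors [E], 10 are paired with [t ^ 10] and 24 are bounded by [2 * n * e]; multiplying by
    [e ^ 10] gives the [e ^ 19 * e ^ 15] that [m] and [d] absorb. *)
Lemma combine_popular m s d t n l K e E :
  0 < e -> E <= 2 * n * e -> t * E <= 2 * n ^ 2 * e -> e <= 2 * n * m -> e <= 2 * n * d ->
  m ^ 19 * d ^ 15 <= (K * l * (n * t) ^ 2) ^ 5 * s ^ 9 ->
  E ^ 34 <= 2 ^ 68 * (K * l) ^ 5 * n ^ 88 * s ^ 9.
Proof.
move=> e0 hE hT hm hd h; have e10 : 0 < e ^ 10 by rewrite expn_gt0 e0.
rewrite -(leq_pmul2l e10).
have k1 := leq_mul (leqnn (e ^ 10 * E ^ 10)) (leq_expn2r 24 hE).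
have k2 := leq_mul (leq_expn2r 19 hm) (leq_expn2r 15 hd).
have k3 := leq_mul (leqnn ((2 * n) ^ 58 * (K * l * n ^ 2) ^ 5 * s ^ 9))
  (leq_expn2r 10 hT).
rewrite (_ : e ^ 10 * E ^ 34 = e ^ 10 * E ^ 10 * E ^ 24); last by ring.
apply: leq_trans k1 _.
rewrite (_ : _ * (2 * n * e) ^ 24 = (2 * n) ^ 24 * E ^ 10 * (e ^ 19 * e ^ 15));
  last by ring.
apply: leq_trans (leq_mul (leqnn _) k2) _.
rewrite (_ : _ * ((2 * n * m) ^ 19 * (2 * n * d) ^ 15)
  = (2 * n) ^ 58 * E ^ 10 * (m ^ 19 * d ^ 15)); last by ring.
apply: leq_trans (leq_mul (leqnn _) h) _.
rewrite (_ : _ * (_ * s ^ 9) = (2 * n) ^ 58 * (K * l * n ^ 2) ^ 5 * s ^ 9 * (t * E) ^ 10);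
  last by ring.
apply: leq_trans k3 _.
by rewrite leq_eqVlt; apply/orP; left; apply/eqP; ring.
Qed.

Lemma combine_energy n l K M E :
  0 < n -> n ^ 6 <= K * l * M ^ 2 * E ->
  E ^ 34 <= 2 ^ 68 * (K * l) ^ 5 * n ^ 88 * M ^ 9 ->
  n ^ 116 <= 2 ^ 68 * (K * l) ^ 39 * M ^ 77.
Proof.
move=> n0 h1 h2; have n88 : 0 < n ^ 88 by rewrite expn_gt0 n0.
rewrite -(leq_pmul2l n88).
have k1 := leq_expn2r 34 h1.
have k2 := leq_mul (leqnn ((K * l * M ^ 2) ^ 34)) h2.
rewrite (_ : n ^ 88 * n ^ 116 = (n ^ 6) ^ 34); last by rewrite -expnD -expnM.
apply: leq_trans k1 _; rewrite expnMn; apply: leq_trans k2 _.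
by rewrite leq_eqVlt; apply/orP; left; apply/eqP; ring.
Qed.

Section Main.
Variable F : realFieldType.
Implicit Types A S P : seq F.

Lemma sumset_mul_energy A S l : uniq A -> uniq S -> {in A, forall a, 0 < a}%R ->
  size A < 2 ^ l -> {in A & A, forall a b, (a + b)%R \in S} ->
  energy (fun p => p.1 * p.2)%R (pairs A A) ^ 34
    <= 2 ^ 68 * (8 * 512 * l) ^ 5 * size A ^ 88 * size S ^ 9.
Proof.
move=> uA uS Apos Al AS; set E := energy _ _; pose n := size A.
pose A2 := pairs A A; have sA2 : size A2 = n ^ 2 by rewrite size_allpairs mulnn.
have [n0|n0] := posnP n.
  by rewrite /E /energy big_allpairs (size0nil n0) big_nil exp0n.
pose g z := reps (fun p => p.1 * p.2)%R A2 z.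
have g_le z : g z <= n.
  rewrite /g reps_pairs -[n]muln1 -sum_const_seq; apply: leq_sum_seq => a /Apos a0 /=.
  rewrite (eq_bigr (fun c => nat_of_bool (c == a^-1 * z)%R));
    first by rewrite sum_mem_uniq ?leq_b1.
  by move=> c _; rewrite (can2_eq (mulKf (lt0r_neq0 a0)) (mulVKf (lt0r_neq0 a0))).
(* The popular products: those represented at least half as often as the average over the pairs in
   [A2]. *)
pose T := [seq z <- undup [seq (p.1 * p.2)%R | p <- A2] | E <= 2 * n ^ 2 * g z].
have uT : uniq T by rewrite filter_uniq ?undup_uniq.
pose deg a := count (fun c => (c * a)%R \in T) A.
pose e := \sum_(a <- A) deg a.
have e_pairs : e = count (fun p => (p.1 * p.2)%R \in T) A2.
  rewrite count_sum big_allpairs exchange_big; apply: eq_bigr => a _.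
  by rewrite /deg count_sum.
have hE : E <= 2 * n * e.
  have := @popular_mass _ A2 (fun p => g (p.1 * p.2)%R) n.
  rewrite -/(energy _ _) -/E sA2 expn_gt0 n0 => /(_ isT (fun=> g_le _)) /leq_trans; apply.
  rewrite leq_mul2l e_pairs; apply/orP; right.
  rewrite -!size_filter; apply: uniq_leq_size.
    by rewrite filter_uniq // allpairs_uniq // => -[a b] [c d] _ _ [-> ->].
  move=> p; rewrite !mem_filter => /andP[Ep pA]; rewrite Ep pA /= mem_undup.
  by rewrite (map_f (fun p => p.1 * p.2)%R).
have hT : size T * E <= 2 * n ^ 2 * e.
  rewrite -sum_const_seq; apply: (@leq_trans (\sum_(z <- T) 2 * n ^ 2 * g z)).
    by apply: leq_sum_seq => z; rewrite mem_filter => /andP[].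
  rewrite -big_distrr leq_mul2l; apply/orP; right.
  under eq_bigr do rewrite -[g _]muln1.
  by rewrite (sum_reps _ _ (fun=> 1) uT) e_pairs -sum1_count.
have [e0|e0] := posnP e.
  by move: hE; rewrite e0 muln0 leqn0 => /eqP ->; rewrite exp0n.
(* [d] is [e / (2 * n)] rounded up; its minimality gives [d <= deg a] on [A']. *)
have [d hd dmin] : exists2 d, e <= 2 * n * d & forall d', e <= 2 * n * d' -> d <= d'.
  have ex : exists d, e <= 2 * n * d by exists e; rewrite leq_pmull ?muln_gt0.
  by exists (ex_minn ex); case: ex_minnP.
have d0 : 0 < d by case: d hd {dmin} => //; rewrite muln0 leqNgt e0.
pose A' := [seq a <- A | e <= 2 * n * deg a].
have A'A : {subset A' <= A} by move=> a; rewrite mem_filter => /andP[].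
have uA' : uniq A' by apply: filter_uniq.
have hm : e <= 2 * n * size A'.
  by rewrite size_filter; apply: popular_mass => // a; apply: count_size.
have m0 : 0 < size A' by case: (size A') hm => //; rewrite muln0 leqNgt e0.
have A'deg : {in A', forall a, d <= deg a}.
  by move=> a; rewrite mem_filter => /andP[/dmin].
have A'S : {in A' & A', forall a b, (a + b)%R \in S}.
  by move=> a b /A'A aA /A'A bA; apply: AS.
have sA'S : size A' <= size S.
  case EA : {1 2}A' m0 => [//|a0 s] _; rewrite -EA -(size_map (fun b => a0 + b)%R).
  apply: uniq_leq_size; first by rewrite map_inj_uniq //; apply: addrI.
  by move=> _ /mapP[b bA ->]; apply: A'S => //; rewrite EA mem_head.
pose X := undup [seq (p.1 - p.2)%R | p <- pairs A' A'].
pose Y := undup [seq (p.1 - p.2)%R | p <- pairs A' S].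
have XA : {in pairs A' A', forall p, (p.1 - p.2)%R \in X}.
  by move=> p pA; rewrite mem_undup (map_f (fun p => p.1 - p.2)%R).
have YA : {in pairs A' S, forall p, (p.1 - p.2)%R \in Y}.
  by move=> p pA; rewrite mem_undup (map_f (fun p => p.1 - p.2)%R).
have uX : uniq X by apply: undup_uniq.
have uY : uniq Y by apply: undup_uniq.
apply: (combine_popular e0 hE hT hm hd).
apply: (combine_moments m0 _ (sum_energy_cube uA' uS uX A'S XA)).
- have -> : size A' ^ 4 = size (pairs A' A') ^ 2 by rewrite size_allpairs mulnn -expnM.
  apply: energy_geq => //.
  by move=> _ /allpairsP[[a b] [aA bA ->]]; apply: A'S.
(* The energy is a sum of representation counts over pairs, and the sum of their squares over pairs
   is a third moment over differences. *)
- apply: leq_trans (cauchy_schwarz_size _ _) _; rewrite size_allpairs leq_mul2l.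
  apply/orP; right; rewrite -(sum_reps_sub (fun y => reps _ _ y ^ 2) uY YA).
  under eq_bigr do rewrite -expnS reps_sub //; exact: leqnn.
- have := diff_third_moment uA uA' uA' uT uX Apos A'A Al (leqnn _) d0 A'deg.
  by move/leq_trans; apply; rewrite leq_eqVlt; apply/orP; left; apply/eqP; ring.
have := diff_third_moment uA uA' uS uT uY Apos A'A Al sA'S d0 A'deg.
by move/leq_trans; apply; rewrite leq_eqVlt; apply/orP; left; apply/eqP; ring.
Qed.

Lemma positive_sum_product A P l : uniq A -> uniq P -> {in A, forall a, 0 < a}%R ->
  size A < 2 ^ l ->
  {in A, forall a, {in A & A, forall b c, (a * (b + c))%R \in P}} ->
  size A ^ 116 <= 2 ^ 68 * (8 * 512 * l) ^ 39 * size P ^ 77.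
Proof.
move=> uA uP Apos Al AP.
have [->//|n0] := posnP (size A).
have h1 := mul_energy_lower uA uP Apos Al AP.
pose S := undup [seq (p.1 + p.2)%R | p <- pairs A A].
have AS : {in A & A, forall a b, (a + b)%R \in S}.
  move=> a b aA bA; rewrite mem_undup; apply/mapP; exists (a, b) => //.
  exact: allpairs_f.
have h2 := sumset_mul_energy uA (undup_uniq _) Apos Al AS.
apply: (combine_energy n0 h1 (leq_trans h2 _)).
rewrite leq_mul2l leq_exp2r //; apply/orP; right.
(* A dilate of [A + A] by one element of [A] lies in [P], so [S] is no larger than [P]. *)
case EA : {1}A n0 => [//|a0 s] _; have a0A : a0 \in A by rewrite EA mem_head.
rewrite -(size_map (fun s => a0 * s)%R); apply: uniq_leq_size.
  by rewrite map_inj_uniq ?undup_uniq //; apply/mulfI/lt0r_neq0/Apos.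
move=> _ /mapP[s' + ->]; rewrite mem_undup => /mapP[_ /allpairsP[[b c] [bA cA ->]] ->].
exact: AP.
Qed.
End Main.

(** * Arbitrary sets of reals *)

Section Signs.
Variable F : realFieldType.
Implicit Types A B P : seq F.

(** Some [a] in [A] is nonzero, and [a * (a + b)] is then injective in [b]. This later lets the
    logarithm of [|A|] be replaced by that of [|A(A+A)|]. *)
Lemma size_leq_sum_product A P : uniq A -> 1 < size A ->
  {in A, forall a, {in A & A, forall b c, (a * (b + c))%R \in P}} -> size A <= size P.
Proof.
move=> uA A1 AP.
have [a aA a0] : exists2 a, a \in A & a != 0%R.
  apply/hasP; rewrite has_predC; apply/negP => /allP A0.
  have : size A <= size [:: 0%R : F].
    by apply: uniq_leq_size => // a /A0 /= /eqP ->; rewrite mem_head.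
  by rewrite leqNgt A1.
rewrite -(size_map (fun b => a * (a + b))%R); apply: uniq_leq_size.
  by rewrite map_inj_uniq // => b c /(mulfI a0) /addrI.
by move=> _ /mapP[b bA ->]; apply: AP.
Qed.

(** [B] is the larger of the positive part of [A] and the negated negative part; negating all of
    [a], [b], [c] preserves [a * (b + c)]. The factor 4 rather than 2 absorbs a possible zero. *)
Lemma positive_part A P : uniq A -> 1 < size A ->
  {in A, forall a, {in A & A, forall b c, (a * (b + c))%R \in P}} ->
  exists B, [/\ uniq B, {in B, forall b, 0 < b}%R, size B <= size A,
    size A <= 4 * size B &
    {in B, forall a, {in B & B, forall b c, (a * (b + c))%R \in P}}].
Proof.
move=> uA A1 AP; pose Ap := [seq a <- A | 0 < a]%R; pose An := [seq a <- A | a < 0]%R.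
have sizeA : size A <= size Ap + size An + 1.
  rewrite !size_filter -(count_predC (fun a => 0 < a)%R A) -addnA leq_add2l.
  have := count_predUI (fun a => a < 0)%R (pred1 0%R) A.
  rewrite (count_uniq_mem _ uA) => h.
  apply: (@leq_trans (count (predU (fun a => a < 0)%R (pred1 0%R)) A)).
    by apply: sub_count => a /=; rewrite -leNgt le_eqVlt orbC.
  by have := leq_b1 (0%R \in A); lia.
have arith u v w : u <= v + w + 1 -> 1 < u -> w <= v -> u <= 4 * v by lia.
have [pn|/ltnW np] := leqP (size An) (size Ap).
  exists Ap; split; rewrite ?filter_uniq //.
  - by move=> a; rewrite mem_filter => /andP[].
  - by rewrite size_filter count_size.
  - exact: arith sizeA A1 pn.
  move=> a; rewrite mem_filter => /andP[_ aA] b c.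
  by rewrite !mem_filter => /andP[_ bA] /andP[_ cA]; apply: AP.
exists [seq (- a)%R | a <- An]; split; rewrite ?size_map.
- by rewrite map_inj_uniq ?filter_uniq //; apply: oppr_inj.
- by move=> _ /mapP[a + ->]; rewrite mem_filter oppr_gt0 => /andP[].
- by rewrite size_filter count_size.
- by apply: arith np => //; rewrite [size An + _]addnC.
move=> _ /mapP[a + ->] _ _ /mapP[b + ->] /mapP[c + ->].
rewrite !mem_filter => /andP[_ aA] /andP[_ bA] /andP[_ cA].
by rewrite -opprD mulrNN; apply: AP.
Qed.
End Signs.

Lemma combine_constants n m q a K l M :
  n <= q * m -> m ^ 116 <= a * (K * l) ^ 39 * M ^ 77 ->
  n ^ 116 <= (q ^ 116 * a * K ^ 39).+1 * l ^ 39 * M ^ 77.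
Proof.
move=> nm h; apply: leq_trans (leq_expn2r 116 nm) _; rewrite expnMn.
apply: leq_trans (leq_mul (leqnn _) h) _; rewrite expnMn !mulnA.
by rewrite !leq_mul.
Qed.

Lemma sum_product_bound : exists2 C, 0 < C & forall (F : realFieldType) (A P : seq F),
  uniq A -> uniq P -> 1 < size A ->
  {in A, forall a, {in A & A, forall b c, (a * (b + c))%R \in P}} ->
  size A ^ 116 <= C * (trunc_log 2 (size A)).+1 ^ 39 * size P ^ 77.
Proof.
(* The successor makes positivity immediate, whatever the numeral. *)
exists (4 ^ 116 * 2 ^ 68 * (8 * 512) ^ 39).+1 => [//|].
move=> F A P uA uP A1 /(positive_part uA A1)[B [uB Bpos BA AB BP]].
have Bl : size B < 2 ^ (trunc_log 2 (size A)).+1.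
  by apply: leq_ltn_trans BA _; apply: trunc_log_ltn.
exact: (combine_constants AB (positive_sum_product uB uP Bpos Bl BP)).
Qed.

(* From natural numbers to real powers and logarithms *)
From Stdlib Require Import Reals Lra.
Open Scope fset_scope.

Section Reals.
Local Open Scope R_scope.

Lemma ln_le x y : 0 < x -> x <= y -> ln x <= ln y.
Proof. by move=> x0 [xy|->]; [left; apply: ln_increasing | right]. Qed.

Lemma exp_le x y : x <= y -> exp x <= exp y.
Proof. by move=> [xy|->]; [left; apply: exp_increasing | right]. Qed.

Lemma ln_0 : ln 0 = 0.
Proof. by rewrite /ln; case: Rlt_dec => // h; case: (Rlt_irrefl 0). Qed.

Lemma INR_muln m n : INR (muln m n) = INR m * INR n.
Proof. exact: mult_INR. Qed.

Lemma INR_expn m k : INR (expn m k) = INR m ^ k.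
Proof. by elim: k => [|k IH] //; rewrite expnS INR_muln IH. Qed.

Lemma leq_INR m n : (m <= n)%nat -> INR m <= INR n.
Proof. by move=> /ssrnat.leP; apply: le_INR. Qed.

Lemma ln_INR_trunc_log n : (0 < n)%nat -> INR (trunc_log 2 n) <= log2 (INR n).
Proof.
move=> n0; have ln2 : 0 < ln 2 by have := ln_lt_2; lra.
have /andP[/leq_INR h _] := trunc_log_bounds (isT : (1 < 2)%nat) n0.
rewrite INR_expn in h; rewrite /log2; apply: (Rmult_le_reg_r (ln 2)) => //.
rewrite /Rdiv Rmult_assoc Rinv_l ?Rmult_1_r; last lra.
have two : INR 2 = 2 by [].
rewrite two in h; rewrite -ln_pow; last lra.
by apply: ln_le => //; apply: pow_lt; lra.
Qed.

Lemma sum_product_log2 : exists2 c, 0 < c & forall A : {fset R}, (0 < #|` A|)%nat ->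
  INR #|` AAplusA A| >=
    c * Rpower (INR #|` A|) (3 / 2 + 1 / 178) / Rpower (log2 (INR #|` AAplusA A|)) 1.
Proof.
have [K K0 bound] := sum_product_bound.
have ln2 : 0 < ln 2 by have := ln_lt_2; lra.
(* The factor [2 ^ 39] pays for bounding [(trunc_log 2 n).+1] by [2 * log2 (INR M)]. *)
pose C1 := INR K * 2 ^ 39.
have C1_ge1 : 1 <= C1.
  have : 1 <= INR K by apply: (leq_INR K0).
  have : 1 <= 2 ^ 39 by apply: pow_R1_Rle; lra.
  rewrite /C1; nra.
have lnC1 : 0 <= ln C1 by rewrite -ln_1; apply: ln_le; lra.
exists (exp (- (ln C1 / 77))); first exact: exp_pos.
move=> A A0; set M := #|` AAplusA A|; set n := #|` A|.
have AP : {in (A : seq R), forall a, {in (A : seq R) & (A : seq R), forall b c,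
    GRing.mul a (GRing.add b c) \in (AAplusA A : seq R)}}.
  move=> a aA b c bA cA; apply/imfset2P; exists a => //; exists (b + c) => //.
  by apply/imfset2P; exists b => //; exists c.
have M0 : (0 < M)%nat.
  have [a aA] : exists a, a \in A by apply/fset0Pn; rewrite -cardfs_gt0.
  by rewrite cardfs_gt0; apply/fset0Pn; exists (a * (a + a)); apply: AP.
have c_le1 : exp (- (ln C1 / 77)) <= 1 by rewrite -exp_0; apply: exp_le; lra.
have M1 : 1 <= INR M by apply: (leq_INR M0).
case: (leqP n 1) => n1.
  have -> : n = 1%nat by apply/eqP; rewrite eqn_leq n1.
  rewrite /Rpower ln_1 Rmult_0_r exp_0 Rmult_1_r Rmult_1_l; apply: Rle_ge.
  apply: Rle_trans M1; case: (leqP M 1) => M2.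
    (* The logarithm in the denominator is 0 here, but [Rpower 0 1 = exp (1 * ln 0) = 1] because
       [ln 0 = 0]. *)
    have -> : M = 1%nat by apply/eqP; rewrite eqn_leq M2.
    by rewrite /log2 ln_1 /Rdiv Rmult_0_l ln_0 exp_0; lra.
  have L1 : 1 <= log2 (INR M).
    rewrite /log2; apply: (Rmult_le_reg_r (ln 2)) => //.
    rewrite /Rdiv Rmult_assoc Rinv_l; last lra.
    have : 2 <= INR M by apply: (leq_INR M2).
    by rewrite Rmult_1_r Rmult_1_l => h; apply: ln_le; lra.
  rewrite exp_ln; last lra.
  apply: (Rmult_le_reg_r (log2 (INR M))); first lra.
  rewrite /Rdiv Rmult_assoc Rinv_l; lra.
have nM : (n <= M)%nat := size_leq_sum_product (fset_uniq A) n1 AP.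
have {bound} := bound _ _ _ (fset_uniq A) (fset_uniq (AAplusA A)) n1 AP.
move=> /leq_INR; rewrite INR_expn (INR_muln (muln _ _)) (INR_muln K) !INR_expn -/n -/M.
have n_gt1 : 2 <= INR n by apply: (leq_INR n1).
have nM' := leq_INR nM.
have ln_n : 0 < ln (INR n) by rewrite -ln_1; apply: ln_increasing; lra.
set L := log2 (INR M).
have log_n1 : 1 <= log2 (INR n).
  rewrite /log2; apply: (Rmult_le_reg_r (ln 2)) => //.
  rewrite /Rdiv Rmult_assoc Rinv_l; last lra.
  by rewrite Rmult_1_r Rmult_1_l; apply: ln_le; lra.
have log_nM : log2 (INR n) <= L.
  rewrite /L /log2 /Rdiv; apply: Rmult_le_compat_r.
    by apply/Rlt_le/Rinv_0_lt_compat.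
  by apply: ln_le; lra.
have log_l : INR (trunc_log 2 n).+1 <= 2 * L.
  by rewrite S_INR; have := ln_INR_trunc_log A0; rewrite -/n; lra.
have l0 : 0 <= INR (trunc_log 2 n).+1 by apply: pos_INR.
move=> bound.
(* As [L >= 1], the factor [L ^ 39] may be enlarged to [L ^ 77]; the 77th root then leaves exactly
   one factor [L]. *)
have {}bound : INR n ^ 116 <= C1 * L ^ 77 * INR M ^ 77.
  apply: Rle_trans bound _; apply: Rmult_le_compat_r; first by apply: pow_le; lra.
  rewrite /C1 Rmult_assoc; apply: Rmult_le_compat_l; first exact: pos_INR.
  apply: Rle_trans (pow_incr _ _ 39 (conj l0 log_l)) _.
  rewrite Rpow_mult_distr; apply: Rmult_le_compat_l; first by apply: pow_le; lra.
  by apply: Rle_pow; [lra | lia].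
have ln_bound : 116 * ln (INR n) <= ln C1 + 77 * ln L + 77 * ln (INR M).
  have h k x : 0 < x -> INR k * ln x = ln (x ^ k) by move=> x0; rewrite ln_pow.
  have h116 : 116 = INR 116 by rewrite INR_IZR_INZ.
  have h77 : 77 = INR 77 by rewrite INR_IZR_INZ.
  rewrite h116 h77 !h; try lra.
  have L77 : 0 < L ^ 77 by apply: pow_lt; lra.
  have M77 : 0 < INR M ^ 77 by apply: pow_lt; lra.
  rewrite -!ln_mult //; try lra; last by apply: Rmult_lt_0_compat; lra.
  by apply: ln_le => //; apply: pow_lt; lra.
rewrite Rpower_1; last lra.
apply/Rle_ge/(Rmult_le_reg_r L); first lra.
rewrite /Rdiv Rmult_assoc Rinv_l; last lra.
rewrite Rmult_1_r /Rpower -exp_plus -[X in _ <= X]exp_ln;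
  last by apply: Rmult_lt_0_compat; lra.
(* This uses [ln (INR n) > 0] and [116 / 77 > 3 / 2 + 1 / 178 = 134 / 89]. *)
apply: exp_le; rewrite ln_mult; lra.
Qed.
End Reals.

(* X >~ Y : exist absolute C, c > 0 with X >= c * Y / (log2 X)^C *)
Theorem theorem2p6 :
  exists C c : R, (0 < C)%R /\ (0 < c)%R /\
    forall A : {fset R}, (0 < #|` A|)%N ->
      (INR #|` AAplusA A| >=
         c * Rpower (INR #|` A|) (3 / 2 + 1 / 178)
           / Rpower (log2 (INR #|` AAplusA A|)) C)%R.
Proof.
have [c c0 h] := sum_product_log2.
by exists 1%R, c; split; [exact: Rlt_0_1 | split].
Qed.
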